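(* For positive integers $m\ge n\ge p$, let $\operatorname{maxrank}_+(m,n,p)$ denote the maximum nonnegative typical rank of $\mathbb{R}_+^{m\times n\times p}$. Then $$\operatorname{maxrank}_+(m,n,p)=\begin{cases} np & \text{if } m=n\ge p,\\ n^2 & \text{if } m\ge n=p,\\ np & \text{if } m>n>p.\end{cases}$$
   Context: $\mathbb{R}_+^{m\times n\times p}$ is the set of real $m\times n\times p$ hypermatrices (elements of $\mathbb{R}^m\otimes\mathbb{R}^n\otimes\mathbb{R}^p$) with nonnegative entries. The nonnegative rank $\operatorname{rank}_+(A)$ of $A\in\mathbb{R}_+^{m\times n\times p}$ is the minimum number $r$ such that $A=\sum_{i=1}^r u_i\otimes v_i\otimes w_i$ with all of $u_i\in\mathbb{R}^m$, $v_i\in\mathbb{R}^n$, $w_i\in\mathbb{R}^p$ having nonnegative entries. An integer $r$ is a nonnegative typical rank of $\mathbb{R}_+^{m\times n\times p}$ if $\{A\in\mathbb{R}_+^{m\times n\times p}:\operatorname{rank}_+(A)=r\}$ contains a nonempty (Euclidean) open subset of $\mathbb{R}^{m\times n\times p}$; the maximum nonnegative typical rank is the largest such $r$. *)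

(* Defs.v *)
From mathcomp Require Import all_boot all_order all_algebra.
From mathcomp Require Import all_classical all_reals all_analysis.
Import numFieldNormedType.Exports.

Set Implicit Arguments.
Unset Strict Implicit.
Unset Printing Implicit Defensive.

Local Open Scope classical_set_scope.
Local Open Scope ring_scope.

(* R^(m x n x p); as the index set is finite, the product topology is the
   Euclidean one. *)
Definition hypermatrix (R : realType) (m n p : nat) : topologicalType :=
  prod_topology (fun _ : 'I_m * 'I_n * 'I_p => R).

Definition nonneg_hypermatrix (R : realType) (m n p : nat) :
    set (hypermatrix R m n p) :=
  [set A | forall x, 0 <= A x].

Definition nonneg_vector (R : realType) (m : nat) (u : 'rV[R]_m) : Prop :=
  forall i, 0 <= u ord0 i.

Definition outer (R : realType) (m n p : nat)
    (u : 'rV[R]_m) (v : 'rV[R]_n) (w : 'rV[R]_p) : hypermatrix R m n p :=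
  fun x => let: (i, j, k) := x in u ord0 i * v ord0 j * w ord0 k.

Definition nonneg_decomposition (R : realType) (m n p : nat)
    (A : hypermatrix R m n p) (r : nat) : Prop :=
  exists (u : 'I_r -> 'rV[R]_m) (v : 'I_r -> 'rV[R]_n) (w : 'I_r -> 'rV[R]_p),
    (forall a, [/\ nonneg_vector (u a), nonneg_vector (v a)
                 & nonneg_vector (w a)]) /\
    (forall x, A x = \sum_(a < r) outer (u a) (v a) (w a) x).

(* [is_nonneg_rank A r] reads rank_+(A) = r. *)
Definition is_nonneg_rank (R : realType) (m n p : nat)
    (A : hypermatrix R m n p) (r : nat) : Prop :=
  nonneg_decomposition A r /\
  (forall s : nat, nonneg_decomposition A s -> (r <= s)%N).

Definition nonneg_typical_rank (R : realType) (m n p r : nat) : Prop :=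
  exists U : set (hypermatrix R m n p),
    [/\ open U, U !=set0 &
        U `<=` [set A | nonneg_hypermatrix A /\ is_nonneg_rank A r]].

(* [is_maxrank_plus R m n p r] reads maxrank_+(m,n,p) = r; it includes the
   existence of the maximum. *)
Definition is_maxrank_plus (R : realType) (m n p r : nat) : Prop :=
  nonneg_typical_rank R m n p r /\
  (forall s : nat, nonneg_typical_rank R m n p s -> (s <= r)%N).

(* Main.v *)
Require Import Defs.
From mathcomp Require Import all_boot all_order all_algebra.
From mathcomp Require Import all_classical all_reals all_analysis.
From mathcomp Require Import ring lra.
Import Order.TTheory GRing.Theory Num.Theory.
Import numFieldNormedType.Exports.

Set Implicit Arguments.
Unset Strict Implicit.
Unset Printing Implicit Defensive.

Local Open Scope classical_set_scope.
Local Open Scope ring_scope.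

(** Slicing along the first mode writes every nonnegative tensor as a sum of
    [n * p] nonnegative rank one terms [A(:,j,k) (x) e_j (x) e_k].  Conversely,
    the cells [(j + k mod n, j, k)] form a partial Latin square: changing one
    coordinate of a cell leaves the set.  If one nonnegative rank one term is
    large at two such cells, then exchanging a coordinate of these cells
    preserves the product of its values, hence the term cannot be small at both
    exchanged cells, one of which is off the set.  So a tensor of size about 1
    on the cells and very small elsewhere, which is an open condition, needs one
    term per cell. *)

Lemma nonneg_decomposition_slices (R : realType) (m n p : nat)
    (A : hypermatrix R m n p) :
  nonneg_hypermatrix A -> nonneg_decomposition A (n * p).
Proof.
move=> A0.
have cardE : #|{: 'I_n * 'I_p}| = (n * p)%N by rewrite card_prod !card_ord.
rewrite -cardE.
exists (fun a => \row_i A (i, (enum_val a).1, (enum_val a).2)),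
  (fun a => delta_mx 0 (enum_val a).1), (fun a => delta_mx 0 (enum_val a).2).
split=> [a|[[i j] k]].
  by split=> l; rewrite mxE ?ler0n //; exact: A0.
(* Reindexed by pairs, the sum at [(i, j, k)] keeps only its term at [(j, k)]. *)
rewrite -(big_enum_val (A := {: 'I_n * 'I_p})
  (fun q => outer (\row_i A (i, q.1, q.2)) (delta_mx 0 q.1)
    (delta_mx 0 q.2) (i, j, k))) /=.
rewrite (bigD1 (j, k)) //= big1 ?addr0 => [|[j' k'] /= neq].
  by rewrite !mxE !eqxx !mulr1.
rewrite !mxE /=; move: neq; rewrite xpair_eqE negb_and (eq_sym j') (eq_sym k').
by case/orP=> /negPf ->; rewrite ?mulr0 ?mul0r.
Qed.

Lemma nonneg_rank_le (R : realType) (m n p r : nat) (A : hypermatrix R m n p) :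
  nonneg_hypermatrix A -> is_nonneg_rank A r -> (r <= n * p)%N.
Proof. by move=> A0 [_]; apply; exact: nonneg_decomposition_slices. Qed.

(** There are finitely many constraints, each the preimage of an open interval under a continuous
    projection. *)
Lemma open_box (R : realType) (m n p : nat) (lo hi : 'I_m * 'I_n * 'I_p -> R) :
  open ([set A | forall x, lo x < A x < hi x] : set (hypermatrix R m n p)).
Proof.
rewrite openE => A AU; rewrite /interior /=.
apply: (@filter_forall _ _ (fun x B => lo x < B x < hi x) (nbhs A)) => x.
have: nbhs (A x) [set y | lo x < y < hi x].
  rewrite (_ : [set y | _] = [set` `]lo x, hi x[]); last first.
    by apply/seteqP; split=> y /=; rewrite in_itv.
  by apply: near_in_itvoo; rewrite in_itv /=; exact: AU.
exact: (@proj_continuous _ (fun _ : 'I_m * 'I_n * 'I_p => R : topologicalType)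
  x A).
Qed.

(** Nonnegative terms cannot cancel, so none exceeds the sum. *)
Lemma outer_le (R : realType) (m n p r : nat) (A : hypermatrix R m n p)
    (u : 'I_r -> 'rV[R]_m) (v : 'I_r -> 'rV[R]_n) (w : 'I_r -> 'rV[R]_p) :
  (forall a, [/\ nonneg_vector (u a), nonneg_vector (v a)
               & nonneg_vector (w a)]) ->
  (forall x, A x = \sum_(a < r) outer (u a) (v a) (w a) x) ->
  forall a x, 0 <= outer (u a) (v a) (w a) x <= A x.
Proof.
move=> uvw0 AE a x.
have outer_ge0 b : 0 <= outer (u b) (v b) (w b) x.
  by case: x => [[i j] k]; have [u0 v0 w0] := uvw0 b; rewrite !mulr_ge0.
by rewrite outer_ge0 AE (bigD1 a) //= lerDl sumr_ge0.
Qed.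

(** Averaging: [r] terms of size at most [1 / N] sum to at most 1. The product form avoids dividing
    by [N]; if [N] is 0, the sum is empty. *)
Lemma large_summand (R : realType) (r N : nat) (F : 'I_r -> R) :
  (r <= N)%N -> 1 < \sum_(a < r) F a -> exists a, 1 < F a * N%:R.
Proof.
move=> rN F1; apply/existsP; apply: contraLR F1 => /existsPn F1.
rewrite -leNgt; have [N0|N_gt0] := posnP N.
  by move: F F1 rN; rewrite N0; case: r => // F _ _; rewrite big_ord0.
have N0 : 0 < N%:R :> R by rewrite ltr0n.
rewrite -(ler_pM2r N0) mulr_suml mul1r.
apply: (@le_trans _ _ (\sum_(a < r) 1)).
  by apply: ler_sum => a _; rewrite leNgt.
by rewrite sumr_const card_ord ler_nat.
Qed.

Definition latin (m n p : nat) (x : 'I_m * 'I_n * 'I_p) : bool :=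
  (x.1.1 == (x.1.2 + x.2) %% n :> nat)%N.

Lemma latin_eq2 (m n p : nat) (i : 'I_m) (j j' : 'I_n) (k : 'I_p) :
  latin (i, j, k) -> latin (i, j', k) -> j = j'.
Proof.
rewrite /latin /= => /eqP -> /eqP /eqP; rewrite eqn_modDr.
by rewrite !modn_small // => /eqP; exact: val_inj.
Qed.

Lemma latin_eq3 (m n p : nat) (le_pn : (p <= n)%N) (i : 'I_m) (j : 'I_n)
    (k k' : 'I_p) :
  latin (i, j, k) -> latin (i, j, k') -> k = k'.
Proof.
rewrite /latin /= => /eqP -> /eqP /eqP; rewrite eqn_modDl.
by rewrite !modn_small ?(leq_trans _ le_pn) // => /eqP; exact: val_inj.
Qed.

Lemma latin_fooling (R : realType) (m n p r : nat) (A : hypermatrix R m n p)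
    (le_pn : (p <= n)%N) (le_nm : (n <= m)%N) :
  (forall x, latin x -> 1 < A x < 2) ->
  (forall x, ~~ latin x -> 2 * A x * (n * p)%:R ^+ 2 < 1) ->
  nonneg_decomposition A r -> (n * p <= r)%N.
Proof.
move=> Abig Asmall [u [v [w [uvw0 AE]]]].
rewrite leqNgt; apply/negP => lt_r.
set N := (n * p)%N in lt_r Asmall.
have n_gt0 : (0 < n)%N.
  by rewrite lt0n; apply: contraTneq lt_r => n0; rewrite /N n0.
pose T a := outer (u a) (v a) (w a).
have TA a x : 0 <= T a x <= A x by exact: outer_le.
(* Off the cells, [A x] is even below [1 / (2 * N ^ 2)], and [N] is at least 1 because [r < N]. *)
have A_lt2 x : A x < 2.
  have [/Abig/andP[]//|/Asmall] := boolP (latin x).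
  have : 1 <= N%:R ^+ 2 :> R by rewrite -natrX ler1n expn_gt0 (leq_trans _ lt_r).
  by nra.
pose cell (q : 'I_n * 'I_p) : 'I_m * 'I_n * 'I_p :=
  (widen_ord le_nm (Ordinal (ltn_pmod (q.1 + q.2) n_gt0)), q.1, q.2).
have cellP q : latin (cell q) by rewrite /latin.
have Tlarge q : exists a, 1 < T a (cell q) * N%:R.
  by apply: large_summand (ltnW lt_r) _; rewrite -AE; case/andP: (Abig _ (cellP q)).
(* The product at [x], [x'] exceeds [1 / N ^ 2]. If [y] were off the cells, the product at [y], [y']
   would be at most [2 * A y], which is below [1 / N ^ 2]. *)
have exchange a x x' y y' : 1 < T a x * N%:R -> 1 < T a x' * N%:R ->
    T a x * T a x' = T a y * T a y' -> latin y.
  move=> x1 x'1 xy; apply: contraT => /Asmall y1.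
  have /andP[y0 yA] := TA a y; have /andP[y'0 y'A] := TA a y'.
  have yy' : T a y * T a y' <= A y * 2.
    by apply: ler_pM => //; apply: le_trans y'A (ltW (A_lt2 _)).
  have : 1 < T a x * T a x' * N%:R ^+ 2.
    rewrite (_ : _ * _ = (T a x * N%:R) * (T a x' * N%:R)); last by ring.
    by nra.
  have : T a x * T a x' * N%:R ^+ 2 <= A y * 2 * N%:R ^+ 2.
    by rewrite xy ler_wpM2r ?sqr_ge0.
  by lra.
have [f f1] := choice Tlarge.
(* A term shared by two cells forces them to coincide; injectivity then embeds the [N] pairs into
   the [r] terms. *)
have f_inj : injective f.
  move=> [j k] [j' k'] ff.
  pose i := (cell (j, k)).1.1; pose i' := (cell (j', k')).1.1.
  have h : 1 < T (f (j, k)) (i, j, k) * N%:R := f1 (j, k).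
  have h' : 1 < T (f (j, k)) (i', j', k') * N%:R by rewrite ff; exact: f1 (j', k').
  have L : latin (i, j, k) := cellP (j, k).
  have L' : latin (i', j', k') := cellP (j', k').
  (* Swapping the third coordinates puts [(i, j, k')] among the cells. *)
  have kk' : k = k'.
    apply: (latin_eq3 le_pn L).
    apply: (exchange _ _ _ _ (i', j', k) h h').
    by rewrite /T /outer; ring.
  (* Swapping the first coordinates puts [(i', j, k)] among the cells, where [(i', j', k)] already
     is. *)
  have jj' : j = j'.
    rewrite -kk' in L'; apply: latin_eq2 L'.
    apply: (exchange _ _ _ _ (i, j', k') h h').
    by rewrite /T /outer; ring.
  by rewrite jj' kk'.
have := leq_card f f_inj; rewrite card_prod !card_ord -/N.
by rewrite leqNgt lt_r.
Qed.

Lemma maxrank_plus_np (R : realType) (m n p : nat) (p_gt0 : (0 < p)%N)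
    (le_pn : (p <= n)%N) (le_nm : (n <= m)%N) :
  is_maxrank_plus R m n p (n * p).
Proof.
split; last first.
  by move=> s [U [_ [A UA] /(_ A UA)[]]]; exact: nonneg_rank_le.
have N0 : 0 < (n * p)%:R ^+ 2 :> R.
  by rewrite exprn_gt0 // ltr0n muln_gt0 p_gt0 (leq_trans p_gt0).
(* Being below [d] is exactly the smallness condition of [latin_fooling]. *)
pose d : R := (2 * (n * p)%:R ^+ 2)^-1.
have d0 : 0 < d by rewrite invr_gt0 mulr_gt0.
pose lo (x : 'I_m * 'I_n * 'I_p) : R := if latin x then 1 else 0.
pose hi (x : 'I_m * 'I_n * 'I_p) : R := if latin x then 2 else d.
exists [set A | forall x, lo x < A x < hi x]; split.
- exact: open_box.
- exists (fun x => (lo x + hi x) / 2) => x.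
  by rewrite /lo /hi; case: ifP => _; lra.
- move=> A Abox.
  have A0 : nonneg_hypermatrix A.
    by move=> x; have := Abox x; rewrite /lo; case: ifP => _; lra.
  split=> //; split; first exact: nonneg_decomposition_slices.
  move=> s; apply: latin_fooling => // x Lx; have := Abox x; rewrite /lo /hi.
    by rewrite Lx.
  rewrite (negPf Lx) => /andP[_].
  by rewrite /d -div1r ltr_pdivlMr ?(mulr_gt0 _ N0) // mulrCA mulrA.
Qed.

Theorem proposition6p6 (R : realType) (m n p : nat)
    (p_gt0 : (0 < p)%N) (le_pn : (p <= n)%N) (le_nm : (n <= m)%N) :
  [/\ m = n -> is_maxrank_plus R m n p (n * p)%N,
      n = p -> is_maxrank_plus R m n p (n ^ 2)%N
    & (n < m)%N -> (p < n)%N -> is_maxrank_plus R m n p (n * p)%N].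
Proof.
have max_np := maxrank_plus_np R p_gt0 le_pn le_nm.
(* All three cases have the value [n * p], which is [n ^ 2] when [n = p]. *)
by split=> // np; rewrite -mulnn [X in (_ * X)%N]np.
Qed.
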